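(* Let $(S,+,\circ)$ be a dual weak brace. Then the following hold: 1. a full inverse subsemigroup $I$ of $(S,+)$ is a left ideal of $S$ if and only if $S\cdot I\subseteq I$; 2. if $I$ is an ideal of $S$, then $S\cdot I\subseteq I$ and $I\cdot S\subseteq I$; 3. a normal subsemigroup $I$ of $(S,+)$ is an ideal of $S$ if and only if $I\cdot S\subseteq I$ and $\lambda_a(I)\subseteq I$ for every $a\in S$.
   Context: A dual weak brace is a triple $(S,+,\circ)$ such that $(S,+)$ is an inverse semigroup, $(S,\circ)$ is a Clifford semigroup (inverse semigroup with central idempotents), and $a\circ(b+c)=a\circ b-a+a\circ c$, $a\circ a^-=-a+a$ for all $a,b,c$, where $-a$, $a^-$ are the inverses of $a$ in $(S,+)$, $(S,\circ)$; then $(S,+)$ is also Clifford and the idempotents of both operations coincide, their set being $\mathrm{E}(S)$. Put $\lambda_a(b)=-a+a\circ b$ and $a\cdot b=-a+a\circ b-b$. For subsets $X,Z\subseteq S$, $X\cdot Z$ denotes the inverse subsemigroup of $(S,+)$ generated by all $x\cdot z$, $x\in X$, $z\in Z$. A subset of $S$ is full if it contains $\mathrm{E}(S)$. A left ideal of $S$ is a full inverse subsemigroup $I$ of $(S,+)$ with $\lambda_a(I)\subseteq I$ for all $a\in S$. A normal subsemigroup of a Clifford semigroup $T$ is a subset $I$ containing all idempotents of $T$, closed under products and inverses, with $a^{-1}Ia\subseteq I$ for all $a\in T$. An ideal of $S$ is a subset $I$ that is a normal subsemigroup of both $(S,+)$ and $(S,\circ)$ and satisfies $\lambda_a(I)\subseteq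 I$ for all $a\in S$. *)

(* Defs.v *)
From mathcomp Require Import all_boot.
From mathcomp Require Import classical_sets.

Set Implicit Arguments.
Unset Strict Implicit.
Unset Printing Implicit Defensive.

Local Open Scope classical_set_scope.

(* The operations are explicit arguments because a dual weak brace carries two
   of them on one type, and the library's additive structures are commutative. *)
Section InverseSemigroups.
Variables (T : Type) (op : T -> T -> T) (inv : T -> T).

Definition inverse_of (a b : T) : Prop :=
  op (op a b) a = a /\ op (op b a) b = b.

Definition idempotents : set T := [set e | op e e = e].

Record inverse_semigroup : Prop := InverseSemigroup {
  inverse_semigroup_assoc : associative op;
  inverse_semigroup_inv : forall a, inverse_of a (inv a);
  inverse_semigroup_uniq : forall a b, inverse_of a b -> b = inv a
}.

Record clifford_semigroup : Prop := CliffordSemigroup {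
  clifford_inverse : inverse_semigroup;
  clifford_central : forall e a, idempotents e -> op e a = op a e
}.

Record inverse_subsemigroup (I : set T) : Prop := InverseSubsemigroup {
  inverse_subsemigroup_op : forall a b, I a -> I b -> I (op a b);
  inverse_subsemigroup_inv : forall a, I a -> I (inv a)
}.

Record normal_subsemigroup (I : set T) : Prop := NormalSubsemigroup {
  normal_full : idempotents `<=` I;
  normal_op : forall a b, I a -> I b -> I (op a b);
  normal_inv : forall a, I a -> I (inv a);
  normal_conj : forall a, [set op (op (inv a) x) a | x in I] `<=` I
}.

Lemma inverse_idempotent e : inverse_semigroup -> idempotents e -> inv e = e.
Proof.
by move=> Hop ee; rewrite -(inverse_semigroup_uniq Hop (a := e) (b := e)) //;
  split; rewrite !ee.
Qed.

End InverseSemigroups.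

Declare Scope brace_scope.
Delimit Scope brace_scope with brace.

Record dualWeakBrace : Type := DualWeakBrace {
  dwb_sort :> Type;
  dwb_add : dwb_sort -> dwb_sort -> dwb_sort;
  dwb_opp : dwb_sort -> dwb_sort;
  dwb_circ : dwb_sort -> dwb_sort -> dwb_sort;
  dwb_inv : dwb_sort -> dwb_sort;
  dwb_add_inverse : inverse_semigroup dwb_add dwb_opp;
  dwb_circ_clifford : clifford_semigroup dwb_circ dwb_inv;
  dwb_circD : forall a b c : dwb_sort,
    dwb_circ a (dwb_add b c) =
    dwb_add (dwb_add (dwb_circ a b) (dwb_opp a)) (dwb_circ a c);
  dwb_circV : forall a : dwb_sort,
    dwb_circ a (dwb_inv a) = dwb_add (dwb_opp a) a
}.

Notation "a + b" := (dwb_add a b) : brace_scope.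
Notation "- a" := (dwb_opp a) : brace_scope.
Notation "a - b" := (dwb_add a (dwb_opp b)) : brace_scope.
Notation "a \circ b" := (dwb_circ a b)
  (at level 40, left associativity) : brace_scope.

Local Open Scope brace_scope.

Section DualWeakBraceTheory.
Variable S : dualWeakBrace.

(* The idempotents of (S, +); those of (S, \circ) are the same, see idemE_circ. *)
Definition idemE : set S := idempotents (@dwb_add S).

Lemma idemE_circ : idemE = idempotents (@dwb_circ S).
Proof.
have HA := dwb_add_inverse S; have [HC _] := dwb_circ_clifford S.
rewrite eqEsubset; split => e ee.
- have E : e \circ dwb_inv e = e by rewrite dwb_circV (inverse_idempotent HA ee).
  have [+ _] := inverse_semigroup_inv HC e.
  by rewrite E.
- have E : e = - e + e by rewrite -dwb_circV (inverse_idempotent HC ee) ee.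
  rewrite /idemE /idempotents /= [LHS](_ : _ = (- e + e) + (- e + e)).
    have [_ H] := inverse_semigroup_inv HA e.
    by rewrite (inverse_semigroup_assoc HA) H -E.
  by rewrite -E.
Qed.

Definition lambda (a b : S) : S := - a + a \circ b.

Definition dot (a b : S) : S := - a + a \circ b - b.

Definition set_dot (X Z : set S) : set S :=
  smallest (inverse_subsemigroup (@dwb_add S) (@dwb_opp S))
           [set dot x z | x in X & z in Z].

Definition full (I : set S) : Prop := idemE `<=` I.

Definition lambda_stable (I : set S) : Prop :=
  forall a : S, [set lambda a x | x in I] `<=` I.

Definition full_inverse_subsemigroup (I : set S) : Prop :=
  full I /\ inverse_subsemigroup (@dwb_add S) (@dwb_opp S) I.

Definition left_ideal (I : set S) : Prop :=
  full_inverse_subsemigroup I /\ lambda_stable I.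

Record ideal (I : set S) : Prop := Ideal {
  ideal_normal_add : normal_subsemigroup (@dwb_add S) (@dwb_opp S) I;
  ideal_normal_circ : normal_subsemigroup (@dwb_circ S) (@dwb_inv S) I;
  ideal_lambda : lambda_stable I
}.

End DualWeakBraceTheory.

(* Main.v *)
Require Import Defs.
From mathcomp Require Import all_boot.
From mathcomp Require Import classical_sets.

Set Implicit Arguments.
Unset Strict Implicit.

Local Open Scope classical_set_scope.

(* Additivity of [a \circ _] shows that the two products agree on idempotents;
   then [-a + a = a \circ a^-] is a left unit of [a] for [+], which forces
   [(S, +)] to be Clifford, and [e \circ a = e + a] for every idempotent [e].
   Hence [a \circ b = a + lambda a b], [lambda a x = dot a x + x] and
   [x \circ a = x + dot x a + a]. For an ideal, [x \circ a = a \circ y] with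
   [y = a^- \circ x \circ a], so that [dot x a] is [-x] plus an additive
   conjugate of [lambda a y]. Conversely, [a^- \circ x \circ a] is the additive
   conjugate by [- a^-] of [lambda a^- (x + dot x a)]. *)

(** * Inverse semigroups: commuting idempotents and a criterion for being Clifford *)

Section InverseSemigroupTheory.
Variables (T : Type) (op : T -> T -> T) (inv : T -> T).
Hypothesis Hop : inverse_semigroup op inv.

Local Notation "x * y" := (op x y).

Let opA : associative op. Proof. exact: inverse_semigroup_assoc Hop. Qed.

Lemma mulVK a : a * inv a * a = a.
Proof. by have [] := inverse_semigroup_inv Hop a. Qed.

Lemma inverse_invK : involutive inv.
Proof.
move=> a; have [H1 H2] := inverse_semigroup_inv Hop a.
by rewrite -(inverse_semigroup_uniq Hop (a := inv a) (b := a)).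
Qed.

Lemma idempotent_mulVr a : idempotents op (a * inv a).
Proof. by rewrite /idempotents /= opA mulVK. Qed.

Lemma idempotent_mulVl a : idempotents op (inv a * a).
Proof. by rewrite -{2}(inverse_invK a); apply: idempotent_mulVr. Qed.

(** With [x] the inverse of [e * f], the element [f * x * e] is an inverse too. By uniqueness
    [x = f * x * e], so [x] is idempotent and equals its own inverse [e * f]. *)
Lemma idempotent_mul e f :
  idempotents op e -> idempotents op f -> idempotents op (e * f).
Proof.
move=> ee ff; set x := inv (e * f).
have eeK z : z * e * e = z * e by rewrite -opA ee.
have ffK z : z * f * f = z * f by rewrite -opA ff.
have [H1 H2] := inverse_semigroup_inv Hop (e * f); rewrite -/x !opA in H1 H2.
have {}H2 z : z * x * e * f * x = z * x by rewrite -[in RHS]H2 !opA.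
have xE : f * x * e = x.
  apply: (inverse_semigroup_uniq Hop); split; rewrite !opA !eeK !ffK //.
  by rewrite H2.
have xx : x * x = x by rewrite -xE !opA H2.
have <- : x = e * f.
  rewrite -(inverse_invK (e * f)) -/x.
  by apply: (inverse_semigroup_uniq Hop); split; rewrite !xx.
exact: xx.
Qed.

(** Both [f * e] and the idempotent [e * f] are inverses of [e * f]. *)
Lemma idempotent_mulC e f :
  idempotents op e -> idempotents op f -> e * f = f * e.
Proof.
move=> ee ff.
have ef := idempotent_mul ee ff; have fe := idempotent_mul ff ee.
have eeK z : z * e * e = z * e by rewrite -opA ee.
have ffK z : z * f * f = z * f by rewrite -opA ff.
rewrite -(inverse_idempotent Hop ef).
symmetry; apply: (inverse_semigroup_uniq Hop).
rewrite /idempotents /= !opA in ef fe.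
by split; rewrite !opA eeK ffK.
Qed.

Lemma inverse_invM a b : inv (a * b) = inv b * inv a.
Proof.
have C z : z * b * inv b * inv a * a = z * inv a * a * b * inv b.
  rewrite -!(opA z) -!opA (opA b) (opA (inv a)).
  congr (_ * _); exact: idempotent_mulC (idempotent_mulVr b) (idempotent_mulVl a).
symmetry; apply: (inverse_semigroup_uniq Hop); split; rewrite !opA.
  by rewrite C mulVK -!opA (opA b) mulVK.
rewrite -C; have := mulVK (inv b); rewrite inverse_invK => ->.
by have := mulVK (inv a); rewrite inverse_invK -!opA => ->.
Qed.

(** The hypothesis at [a] and at [inv a] makes each of these two commuting idempotents absorb the
    other. *)
Lemma inverse_mulVC : (forall a, inv a * a * a = a) ->
  forall a, a * inv a = inv a * a.
Proof.
move=> H a.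
have E1 : inv a * a * (a * inv a) = a * inv a by rewrite opA H.
have E2 : a * inv a * (inv a * a) = inv a * a.
  by have := H (inv a); rewrite inverse_invK opA => ->.
rewrite -E1 -[RHS]E2.
exact: idempotent_mulC (idempotent_mulVl a) (idempotent_mulVr a).
Qed.

Lemma clifford_mulVC : clifford_semigroup op inv ->
  forall a, a * inv a = inv a * a.
Proof.
move=> HC; apply: inverse_mulVC => a.
by rewrite (clifford_central HC a (idempotent_mulVl a)) opA mulVK.
Qed.

(** Equality of the two local units of [e * a] reads [inv a * e * a = a * inv a * e], which carries
    [e] across [a]. *)
Lemma clifford_of_local_units :
  (forall a, inv a * a * a = a) -> clifford_semigroup op inv.
Proof.
move=> H; split=> // e a ee.
have eC : a * inv a * e = e * (a * inv a).
  exact: idempotent_mulC (idempotent_mulVr a) ee.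
have E : inv a * e * a = a * inv a * e.
  have := inverse_mulVC H (e * a).
  rewrite inverse_invM (inverse_idempotent Hop ee) !opA.
  by rewrite -(opA _ e e) ee -(opA e a) -eC -opA ee.
rewrite -{1}(mulVK a) opA -eC -!opA (opA (inv a)) E (inverse_mulVC H).
by rewrite !opA mulVK.
Qed.

End InverseSemigroupTheory.

Local Open Scope brace_scope.

(** * Action of the idempotents under both operations of a dual weak brace *)

Section DualWeakBraceTheory.
Variable S : dualWeakBrace.
Implicit Types (a b e f x : S) (I : set S).

Let HA : inverse_semigroup (@dwb_add S) (@dwb_opp S) := dwb_add_inverse S.
Let HC : clifford_semigroup (@dwb_circ S) (@dwb_inv S) := dwb_circ_clifford S.
Let HCi : inverse_semigroup (@dwb_circ S) (@dwb_inv S) := clifford_inverse HC.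
Let addA : associative (@dwb_add S) := inverse_semigroup_assoc HA.
Let circA : associative (@dwb_circ S) := inverse_semigroup_assoc HCi.

Let oppK : involutive (@dwb_opp S) := inverse_invK HA.

Let addNK a : a - a + a = a.
Proof. exact: mulVK HA a. Qed.

Let oppNK a : - a + a - a = - a.
Proof. by have := addNK (- a); rewrite oppK. Qed.

Let opp_idem e : idemE e -> - e = e.
Proof. exact: (inverse_idempotent HA). Qed.

Let add_idemC e f : idemE e -> idemE f -> e + f = f + e.
Proof. exact: (idempotent_mulC HA). Qed.

Let idemE_subr a : idemE (a - a).
Proof. exact: (idempotent_mulVr HA). Qed.

Let idemE_subl a : idemE (- a + a).
Proof. exact: (idempotent_mulVl HA). Qed.

Let idemE_add e f : idemE e -> idemE f -> idemE (e + f).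
Proof. exact: (idempotent_mul HA). Qed.

Let circ_idem e : idemE e -> e \circ e = e.
Proof. by rewrite idemE_circ. Qed.

Let circ_idemC e a : idemE e -> e \circ a = a \circ e.
Proof. by rewrite idemE_circ => ee; exact: (clifford_central HC). Qed.

Lemma circ_idemE e f : idemE e -> idemE f -> e \circ f = e + f.
Proof.
(* Distributing over [f' + f' = f'] leaves a middle term [- e' = e']. *)
have absorb e' f' : idemE e' -> idemE f' -> e' \circ f' + e' = e' \circ f'.
  move=> ee ff; have ef : idemE (e' \circ f').
    by rewrite idemE_circ in ee ff *; exact: (idempotent_mul HCi).
  have : e' \circ (f' + f') = e' \circ f' by rewrite ff.
  by rewrite dwb_circD opp_idem // -addA [e' + _]add_idemC // addA ef.
move=> ee ff; have ef : idemE (e \circ f).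
  by have := ee; have := ff; rewrite idemE_circ => ? ?; exact: (idempotent_mul HCi).
have gg := idemE_add ee ff.
have efe : e \circ f + e = e \circ f by exact: absorb.
have eff : e \circ f + f = e \circ f by rewrite circ_idemC // absorb.
have ge : (e + f) \circ e = e \circ f.
  rewrite circ_idemC // dwb_circD opp_idem // circ_idem // [e + e]ee.
  by rewrite add_idemC.
have gf : (e + f) \circ f = e \circ f.
  rewrite circ_idemC // dwb_circD opp_idem // circ_idem // -(circ_idemC _ ee).
  by rewrite !eff.
(* Expand [e + f] as its own [\circ]-square: both outer terms are [e \circ f], which absorbs the
   middle term [e + f]. *)
rewrite -[RHS](circ_idem gg) dwb_circD ge gf opp_idem // addA efe eff.
by rewrite [_ + _]ef.
Qed.

Let circKl a : (- a + a) \circ a = a.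
Proof. by rewrite -dwb_circV; exact: (mulVK HCi). Qed.

Let circD_idem e a : idemE e -> e + e \circ a = e \circ a.
Proof.
move=> ee.
have -> : e \circ a = e + (a - a) - e + e \circ a.
  by rewrite -(circ_idemE ee (idemE_subr a)) -dwb_circD addNK.
by rewrite !addA [e + e]ee.
Qed.

Lemma dwb_add_clifford : clifford_semigroup (@dwb_add S) (@dwb_opp S).
Proof.
apply: (clifford_of_local_units HA) => a.
by have := circD_idem a (idemE_subl a); rewrite circKl.
Qed.

Let addC_idem e a : idemE e -> e + a = a + e.
Proof. exact: (clifford_central dwb_add_clifford). Qed.

Let addKN a : a + (- a + a) = a.
Proof. by rewrite addA addNK. Qed.

Let addVC a : a - a = - a + a.
Proof. exact: (clifford_mulVC HA dwb_add_clifford). Qed.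

(** By distributivity [e \circ a = e \circ (e + a)], and [e] fixes [e + a] because the local unit of
    [e + a] absorbs [e]. *)
Lemma circ_idem_add e a : idemE e -> e \circ a = e + a.
Proof.
move=> ee.
have E : e \circ (e + a) = e \circ a.
  by rewrite dwb_circD circ_idem // opp_idem // [e + e]ee circD_idem.
have D : e \circ (- (e + a) + (e + a)) = - (e + a) + (e + a).
  rewrite circ_idemE // (inverse_invM HA) (opp_idem ee) !addA.
  by rewrite (addC_idem (- a) ee) -!(addA (- a) e e) [e + e]ee -(addA (- a) e e) [e + e]ee.
by rewrite -E -{1}(circKl (e + a)) circA D circKl.
Qed.

(** * Formulas relating [\circ], [lambda] and [dot] *)

Lemma circE_lambda a b : a \circ b = a + lambda a b.
Proof.
by rewrite /lambda addA addVC -circ_idem_add // circA circKl.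
Qed.

(** The point is that [lambda a x] absorbs [- x + x]; distributing over [x = x + (- x + x)] makes
    this idempotent appear. *)
Lemma lambda_dot a x : lambda a x = dot a x + x.
Proof.
rewrite /dot -/(lambda a x) -addA -{1}(addKN x) /lambda dwb_circD.
rewrite -(circ_idemC a (idemE_subl x)) (circ_idem_add a (idemE_subl x)).
rewrite (addC_idem a (idemE_subl x)) !addA.
rewrite -(addA _ (- a) a) -(addC_idem _ (idemE_subl a)) !addA.
by rewrite oppNK.
Qed.

(** The surplus idempotents [x - x] and [- a + a] can be multiplied by [\circ] instead of added, and
    then vanish into [x] and [a]. *)
Lemma circE_dot x a : x \circ a = x + dot x a + a.
Proof.
rewrite /dot !addA addVC -(circ_idem_add _ (idemE_subl x)) circA circKl.
rewrite -addA -(addC_idem _ (idemE_subl a)) -(circ_idem_add _ (idemE_subl a)).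
by rewrite (circ_idemC _ (idemE_subl a)) -circA -(circ_idemC _ (idemE_subl a)) circKl.
Qed.

(** * Ideals in terms of products of elements *)

Lemma set_dot_sub (X Z I : set S) :
  inverse_subsemigroup (@dwb_add S) (@dwb_opp S) I ->
  set_dot X Z `<=` I <-> (forall x z, X x -> Z z -> I (dot x z)).
Proof.
move=> HI; split=> [sub x z Xx Zz|sub].
  by apply: sub; apply: sub_gen_smallest; exists x; last exists z.
by apply: smallest_sub => // _ [x Xx [z Zz <-]]; exact: sub.
Qed.

Lemma normal_inverse_subsemigroup I :
  normal_subsemigroup (@dwb_add S) (@dwb_opp S) I ->
  inverse_subsemigroup (@dwb_add S) (@dwb_opp S) I.
Proof. by case=> _ HD HN _; split. Qed.

Lemma lambda_stable_dotP I : inverse_subsemigroup (@dwb_add S) (@dwb_opp S) I ->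
  lambda_stable I <-> (forall a x, I x -> I (dot a x)).
Proof.
move=> [HD HN]; split=> [HL a x Ix|H a _ [x Ix <-]].
  by apply: (HD _ _ _ (HN _ Ix)); apply: HL; exists x.
by rewrite lambda_dot; apply: HD => //; exact: H.
Qed.

Lemma ideal_dot_mem I : ideal I -> forall x a, I x -> I (dot x a).
Proof.
move=> [[_ HD HN HJ] [_ _ _ HJc] HL] x a Ix.
set y := dwb_inv a \circ x \circ a.
have Iy : I y by apply: (HJc a); exists x.
(* The factor [a \circ dwb_inv a] is a central idempotent that fixes [a]. *)
have E : x \circ a = a \circ y.
  by rewrite /y !circA dwb_circV -circA !(circ_idemC _ (idemE_subl a)) -circA
    -(circ_idemC a (idemE_subl a)) circKl.
have -> : dot x a = - x + (- (- a) + lambda a y - a).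
  by rewrite /dot E circE_lambda oppK !addA.
apply: HD; first exact: HN.
by apply: (HJ (- a)); exists (lambda a y) => //; apply: HL; exists y.
Qed.

Lemma normal_circ I :
  normal_subsemigroup (@dwb_add S) (@dwb_opp S) I -> lambda_stable I ->
  (forall x a, I x -> I (dot x a)) ->
  normal_subsemigroup (@dwb_circ S) (@dwb_inv S) I.
Proof.
move=> [HE HD HN HJ] HL HR.
have {}HL a x : I x -> I (lambda a x) by move=> Ix; apply: HL; exists x.
split.
- by rewrite -idemE_circ.
- by move=> a b Ia Ib; rewrite circE_lambda; apply: HD => //; exact: HL.
- move=> a Ia; rewrite -[dwb_inv a]oppK; apply: (HN).
  (* Stability under [lambda] alone yields the additive opposite of the [\circ]-inverse. *)
  suff <- : lambda (dwb_inv a) a = - dwb_inv a by exact: HL.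
  have := dwb_circV (dwb_inv a); rewrite (inverse_invK HCi) => E.
  by rewrite /lambda E -addVC addA oppNK.
- move=> a _ [x Ix <-].
  (* Distribute [dwb_inv a] over [(x + dot x a) + a]; the last term is the local unit of [dwb_inv a]
     and is absorbed. *)
  have E : dwb_inv a \circ x \circ a =
    - (- dwb_inv a) + lambda (dwb_inv a) (x + dot x a) - dwb_inv a.
    have Ea := dwb_circV (dwb_inv a); rewrite (inverse_invK HCi) in Ea.
    rewrite -circA (circE_dot x a) dwb_circD Ea oppK -circE_lambda.
    by rewrite -addA -addVC (addA (- _)) oppNK.
  rewrite E; apply: (HJ (- dwb_inv a)); exists (lambda (dwb_inv a) (x + dot x a)) => //.
  by apply/HL/HD => //; exact: HR.
Qed.

End DualWeakBraceTheory.

Theorem proposition4p5 (S : dualWeakBrace) :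
  (forall I : set S, full_inverse_subsemigroup I ->
     (left_ideal I <-> set_dot [set: S] I `<=` I)) /\
  (forall I : set S, ideal I ->
     set_dot [set: S] I `<=` I /\ set_dot I [set: S] `<=` I) /\
  (forall I : set S, normal_subsemigroup (@dwb_add S) (@dwb_opp S) I ->
     (ideal I <-> set_dot I [set: S] `<=` I /\
        (forall a : S, [set lambda a x | x in I] `<=` I))).
Proof.
have ideal_dot (I : set S) : ideal I ->
    set_dot [set: S] I `<=` I /\ set_dot I [set: S] `<=` I.
  move=> HI; have [HA _ HL] := HI.
  have HIs := normal_inverse_subsemigroup HA; split; apply/(set_dot_sub _ _ HIs).
    by move=> a x _; apply: (lambda_stable_dotP HIs).1.
  by move=> x a Ix _; exact: ideal_dot_mem.
split; last split=> // I HA.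
  move=> I HI; have [_ HIs] := HI; split.
    move=> [_ /(lambda_stable_dotP HIs) H]; apply/(set_dot_sub _ _ HIs) => a x _.
    exact: H.
  move=> /(set_dot_sub _ _ HIs) H; split=> //; apply/(lambda_stable_dotP HIs) => a x.
  exact: H.
have HIs := normal_inverse_subsemigroup HA; split.
  by move=> HI; split; [have [] := ideal_dot _ HI | exact: ideal_lambda HI].
move=> [/(set_dot_sub _ _ HIs) HR HL]; split=> //.
by apply: normal_circ => // x a Ix; exact: HR.
Qed.
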